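(* Fix an HMM with $\epsilon$-transitions $(S,\Sigma,\delta)$ such that from each state there is an outgoing path of non-zero probability containing a symbol in $\Sigma$, a start state $s_0\in S$, and an observation sequence $\widetilde{y}=a_1\dots a_n=a_1\widetilde{y}_1$ (with $a_i\in\Sigma$, $n\ge1$) such that $P_{s_0}(Y=\widetilde{y})>0$. Let $\mathsf{t}=(s,a,s')$ be a transition and define $$C^{\widetilde{y}}_{s_0,\mathsf{t}}=E_{s_0}[X_{\mathsf{t}}\mid Y=\widetilde{y}]\cdot P_{s_0}(Y=\widetilde{y}),$$ with the same notation for other start states and other observation sequences. Then $C^{\epsilon}_{s_0,\mathsf{t}}=0$ and the following fixpoint equation holds: whenever $a\in\Sigma$, $$C^{\widetilde{y}}_{s_0,\mathsf{t}}=\sum_{s_1\in S}\delta(s_0)(a_1,s_1)\cdot C^{\widetilde{y}_1}_{s_1,\mathsf{t}}+\sum_{s_1\in S}\delta(s_0)(\epsilon,s_1)\cdot C^{\widetilde{y}}_{s_1,\mathsf{t}}+[s_0=s\land a_1=a]\cdot\delta(s)(a,s')\cdot P_{s'}(Y=\widetilde{y}_1),$$ and whenever $a=\epsilon$ the last summand has to be replaced by $[s_0=s]\cdot\delta(s)(\epsilon,s')\cdot P_{s'}(Y=\widetilde{y})$, i.e. $$C^{\widetilde{y}}_{s_0,\mathsf{t}}=\sum_{s_1\in S}\delta(s_0)(a_1,s_1)\cdot C^{\widetilde{y}_1}_{s_1,\mathsf{t}}+\sum_{s_1\in S}\delta(s_0)(\epsilon,s_1)\cdot C^{\widetilde{y}}_{s_1,\mathsf{t}}+[s_0=s]\cdot\delta(s)(\epsilon,s')\cdot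 P_{s'}(Y=\widetilde{y}).$$ Here $[b]=1$ if $b$ holds and $[b]=0$ otherwise.
   Context: An HMM with $\epsilon$-transitions is a triple $(S,\Sigma,\delta)$ with a finite state space $S$, an alphabet $\Sigma$ of observable symbols ($\epsilon$ is a separate symbol, standing for an unobservable transition) and a transition function $\delta\colon S\to\mathcal{D}((\Sigma\cup\{\epsilon\})\times S)$, where $\mathcal{D}(X)$ is the set of probability functions $P\colon X\to[0,1]$ with $\sum_{x\in X}P(x)=1$. Its set of transitions is $T_\delta=\{(s,a,s')\mid s,s'\in S,\ a\in\Sigma\cup\{\epsilon\},\ \delta(s)(a,s')>0\}$. An outgoing path of $s$ of non-zero probability is a sequence $s=r_0,b_1,r_1,\dots,b_m,r_m$ with $r_i\in S$, $b_i\in\Sigma\cup\{\epsilon\}$ and $\delta(r_{i-1})(b_i,r_i)>0$ for all $i$; it contains a symbol in $\Sigma$ if some $b_i\in\Sigma$. For $s_0\in S$ and $n\in\mathbb{N}_0$, $\Omega^n_{s_0}=s_0((\epsilon S)^*\Sigma S)^n$ is the set of alternating sequences $\widetilde{z}=s_0a_1s_1\dots a_ms_m$ with $s_i\in S$, $a_i\in\Sigma\cup\{\epsilon\}$, exactly $n$ of the $a_i$ in $\Sigma$, and (if $n\ge1$) $a_m\in\Sigma$; $\Omega^0_{s_0}=\{s_0\}$. Its probability function is $P^n_{s_0}(\widetilde{z})=\prod_{i=1}^m\delta(s_{i-1})(a_i,s_i)$, with $P^0_{s_0}(s_0)=1$. Random variables on $\Omega^n_{s_0}$: $Z$ is the identity;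 $Y(\widetilde{z})\in\Sigma^n$ is the word of observable symbols of $\widetilde{z}$ (states and $\epsilon$'s removed); $X_{\mathsf{t}}(\widetilde{z})\in\mathbb{N}_0$ is the number of times the transition $\mathsf{t}=(s,a,s')$ occurs in $\widetilde{z}$, i.e. the number of $i$ with $(s_{i-1},a_i,s_i)=\mathsf{t}$. The notations $P_{s_0}(Y=\widetilde{y})$ and $E_{s_0}[\,\cdot\mid Y=\widetilde{y}]$ refer to the probability space $(\Omega^n_{s_0},P^n_{s_0})$ with $n=|\widetilde{y}|$; thus $P_{s_0}(Y=\widetilde{y})=\sum_{Y(\widetilde{z})=\widetilde{y}}P^n_{s_0}(\widetilde{z})$ and $E_{s_0}[X\mid Y=\widetilde{y}]=\sum_{\widetilde{z}\in\Omega^n_{s_0}}X(\widetilde{z})\cdot P(Z=\widetilde{z}\mid Y=\widetilde{y})$, where $P(Z=\widetilde{z}\mid Y=\widetilde{y})=P(Z=\widetilde{z}\land Y=\widetilde{y})/P(Y=\widetilde{y})$, provided that $P(Y=\widetilde{y})>0$. As an observation sequence (superscript of $C$), $\epsilon$ denotes the empty word. *)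

(* Defs.v *)
From HB Require Import structures.
From mathcomp Require Import all_boot all_order all_algebra.
From mathcomp Require Import all_classical all_reals all_analysis.

Set Implicit Arguments.
Unset Strict Implicit.
Unset Printing Implicit Defensive.

Import Order.TTheory GRing.Theory Num.Theory.

Local Open Scope classical_set_scope.
Local Open Scope ring_scope.

(* Elements of D(X): X may be infinite, so the total mass is an [esum]. *)
Definition is_prob_fun (R : realType) (X : choiceType) (P : X -> R) : Prop :=
  (forall x, 0 <= P x <= 1) /\ (\esum_(x in [set: X]) (P x)%:E = 1)%E.

(* The label set Sigma + {epsilon} is [option Sigma], epsilon being [None].
   Only the state space is required to be finite. *)
Record eps_hmm (R : realType) (S : finType) (Sigma : choiceType) := EpsHMM {
  delta : S -> option Sigma * S -> R;
  delta_prob_fun : forall s, is_prob_fun (delta s)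
}.

Section EpsHMM.
Variables (R : realType) (S : finType) (Sigma : choiceType).
Variable M : eps_hmm R S Sigma.

Definition triple : choiceType := (S * option Sigma * S)%type.

Definition tprob (t : triple) : R := delta M t.1.1 (t.1.2, t.2).

Definition is_transition (t : triple) : Prop := 0 < tprob t.

(* The alternating sequence s0 a1 s1 ... am sm is encoded as the pair
   (s0, [:: (a1, s1); ...; (am, sm)]). *)
Definition altseq : choiceType := (S * seq (option Sigma * S))%type.

Fixpoint triples_from (r : S) (p : seq (option Sigma * S)) : seq triple :=
  if p is (b, r') :: p' then (r, b, r') :: triples_from r' p' else [::].

Definition triples (z : altseq) : seq triple := triples_from z.1 z.2.

Definition nonzero_outgoing_path (s : S) (z : altseq) : Prop :=
  z.1 = s /\ (forall t, t \in triples z -> 0 < tprob t).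

Definition observable (x : option Sigma * S) : bool := isSome x.1.

Definition contains_symbol (z : altseq) : Prop := has observable z.2.

Definition always_emits : Prop :=
  forall s, exists z, nonzero_outgoing_path s z /\ contains_symbol z.

(* For n = 0 this leaves only the sequence s0, without trailing epsilons. *)
Definition Omega (n : nat) (s0 : S) : set altseq :=
  [set z | [/\ z.1 = s0, count observable z.2 = n
             & z.2 = [::] \/ exists p x, z.2 = rcons p x /\ observable x]].

Definition seqprob (z : altseq) : R := \prod_(t <- triples z) tprob t.

Definition Yword (z : altseq) : seq Sigma := pmap fst z.2.

Definition Xcount (t : triple) (z : altseq) : nat := count_mem t (triples z).

Local Open Scope ereal_scope.

Definition Pr (n : nat) (s0 : S) (A : set altseq) : \bar R :=
  \esum_(z in Omega n s0 `&` A) (seqprob z)%:E.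

Definition PY (s0 : S) (y : seq Sigma) : \bar R :=
  Pr (size y) s0 [set z | Yword z = y].

(* If Pr n s0 B = 0 the numerator vanishes as well, and the quotient is
   0 * +oo = 0 in the library. *)
Definition cPr (n : nat) (s0 : S) (A B : set altseq) : \bar R :=
  Pr n s0 (A `&` B) / Pr n s0 B.

Definition cE (s0 : S) (X : altseq -> nat) (y : seq Sigma) : \bar R :=
  \esum_(z in Omega (size y) s0)
    (X z)%:R%:E * cPr (size y) s0 [set w | w = z] [set w | Yword w = y].

Definition Ccount (y : seq Sigma) (s0 : S) (t : triple) : \bar R :=
  cE s0 (Xcount t) y * PY s0 y.

End EpsHMM.

(* Main.v *)
Require Import Defs.
From HB Require Import structures.
From mathcomp Require Import all_boot all_order all_algebra.
From mathcomp Require Import all_classical all_reals all_analysis.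

(* Splitting off the first transition of a path emitting [a :: y] gives a
   one-step equation for any path functional; for the count of [t] the first
   transition contributes the extra summand.  Since [PY] is at most 1, it cancels
   in [Ccount], which is therefore the plain sum of count times path probability
   (both vanish when [PY] is 0).
   That sum is finite because the expected length of an emitting path is: as
   every state can emit, the epsilon-transitions admit a nonnegative function [h]
   with [1 + E h <= h], and by induction on the truncation length the expected
   length for [a :: y] is at most a multiple of [h]. *)

Set Implicit Arguments.
Unset Strict Implicit.
Unset Printing Implicit Defensive.

Import Order.TTheory GRing.Theory Num.Theory.

Local Open Scope ereal_scope.

Local Notation "\esum_ ( i 'in' P ) F" := (esum P (fun i => F)) : ereal_scope.

(** * Sums of nonnegative extended reals over sets *)

Section EsumComplements.
Local Open Scope classical_set_scope.

Lemma esum_finType (R : realType) (T : finType) (f : T -> \bar R) :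
  (forall x, 0 <= f x) -> \esum_(x in [set: T]) f x = \sum_x f x.
Proof.
move=> f0; rewrite esum_fset//; last exact: finite_finset.
rewrite (fsbigE (enum T)) ?enum_uniq//; last first.
  by move=> x _; rewrite mem_enum.
by rewrite big_mkcond/= big_enum/=; apply: eq_bigr => x _; rewrite in_setT.
Qed.

Lemma esumZl (R : realType) (T : choiceType) (A : set T) (f : T -> \bar R)
    (c : R) :
  (0 <= c)%R -> (forall x, A x -> 0 <= f x) ->
  \esum_(x in A) (c%:E * f x) = c%:E * \esum_(x in A) f x.
Proof.
move=> c0 f0; rewrite /esum -ereal_supZl//; last first.
  (* Pulling the factor out of the supremum needs a nonempty set of values; the empty finite subset
     provides one. *)
  by apply/set0P; eexists; exists set0; [exact: fsets_set0|reflexivity].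
rewrite image_comp; congr ereal_sup; apply: eq_imagel => /= X [finX XA].
rewrite !fsbig_finite//= big_seq [in RHS]big_seq ge0_sume_distrr// => x.
by rewrite in_fset_set// inE => /XA/f0.
Qed.

Lemma ge0_ler_esum (R : realType) (T : choiceType) (A : set T)
    (f : T -> \bar R) x :
  (forall x, A x -> 0 <= f x) -> A x -> f x <= \esum_(i in A) f i.
Proof.
move=> f0 Ax; apply: esum_ge; exists [set x]; last by rewrite fsbig_set1.
by split=> // ? ->.
Qed.

End EsumComplements.

(** * Paths with a given observable word *)

Section Lang.
Local Open Scope classical_set_scope.
Variables (R : realType) (S : finType) (Sigma : choiceType).

(** The start state is dropped so that the tail of a path lies in a set of the same kind, whatever
    state it starts from. The symbol count required by [Omega] is implied by the word. *)
Definition Lang (y : seq Sigma) : set (seq (option Sigma * S)) :=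
  [set p | pmap fst p = y /\
           (p = [::] \/ exists q x, p = rcons q x /\ observable x)].

Lemma last_observable_cons (x : option Sigma * S) p : p != [::] ->
  (exists q z, x :: p = rcons q z /\ observable z) <->
  (exists q z, p = rcons q z /\ observable z).
Proof.
move=> p0; split=> -[q [z [e oz]]]; last first.
  by exists (x :: q), z; rewrite e.
case: q e => [|w q] /= [_ ep]; first by rewrite ep in p0.
by exists q, z.
Qed.

Lemma Lang_nil : Lang [::] = [set [::]].
Proof.
apply/seteqP; split=> p /=; last by move=> ->; split; [|left].
move=> [py [//|[q [x [ep ox]]]]].
have: size (pmap fst p) = 0%N by rewrite py.
by rewrite ep size_pmap -cats1 count_cat/=; move: ox; rewrite /observable addnC => ->.
Qed.

(** An epsilon-transition leaves the word unchanged, so [Lang (a :: y)] recurs in its own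
    decomposition: this is no recursion on the word alone. *)
Lemma Lang_cons a y : Lang (a :: y) =
  (fun x => (Some a, x.1) :: x.2) @` ([set: S] `*` Lang y) `|`
  (fun x => (None, x.1) :: x.2) @` ([set: S] `*` Lang (a :: y)).
Proof.
apply/seteqP; split.
  case=> [[]//|[[b|] r] p] /= [] /=.
    move=> [<- <-] [//|lp]; left; exists (r, p) => //; split=> //; split=> //.
    have [->|p0] := eqVneq p [::]; first by left.
    by right; move: lp => /(last_observable_cons _ p0).
  move=> py [//|lp]; right; exists (r, p) => //; split=> //; split=> //.
  have p0 : p != [::] by apply/eqP => p0; rewrite p0 in py.
  by right; move: lp => /(last_observable_cons _ p0).
move=> _ [] [[r p] [_ /= [py lp]] <-]/=; split=> /=; rewrite ?py//; right.
  have [->|p0] := eqVneq p [::]; first by exists [::], (Some a, r).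
  by case: lp => [/eqP|lp]; [rewrite (negbTE p0)|exact/(last_observable_cons _ p0)].
have p0 : p != [::] by apply/eqP => p0; rewrite p0 in py.
by case: lp => [/eqP|lp]; [rewrite (negbTE p0)|exact/(last_observable_cons _ p0)].
Qed.

Lemma esum_cons (b : option Sigma) (A : set (seq (option Sigma * S)))
    (f : seq (option Sigma * S) -> \bar R) : (forall p, 0 <= f p) ->
  \esum_(p in (fun x => (b, x.1) :: x.2) @` ([set: S] `*` A)) f p
   = \sum_(r : S) \esum_(p in A) f ((b, r) :: p).
Proof.
move=> f0; rewrite esum_image; last by move=> [r p] [r' p'] _ _ /= [-> ->].
rewrite -esum_finType; last by move=> r; apply: esum_ge0.
by rewrite esum_esum.
Qed.

Lemma esum_Lang_cons a y (f : seq (option Sigma * S) -> \bar R) :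
  (forall p, 0 <= f p) ->
  \esum_(p in Lang (a :: y)) f p
   = \sum_(r : S) \esum_(p in Lang y) f ((Some a, r) :: p)
     + \sum_(r : S) \esum_(p in Lang (a :: y)) f ((None, r) :: p).
Proof.
(* The split is by membership in [B]; the two images in [Lang_cons] are disjoint because their first
   labels differ. *)
move=> f0; pose B : set (seq (option Sigma * S)) :=
  (fun x => (Some a, x.1) :: x.2) @` ([set: S] `*` Lang y).
rewrite -!esum_cons// (esumID B)//; congr (_ + _); congr esum.
  by rewrite Lang_cons setIC setIUr setIid; apply: setUidl => ? [].
rewrite {1}Lang_cons setIUl setICr set0U; apply: setIidl.
by move=> _ [[r p] _ <-] /= [[r' p'] _ /=].
Qed.

End Lang.

(** * A potential for a substochastic matrix *)

Section Potential.
Variables (R : realType) (S : finType) (E : S -> S -> R).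
Hypothesis E_ge0 : forall s r, (0 <= E s r)%R.
Hypothesis E_le1 : forall s, (\sum_r E s r <= 1)%R.
Local Open Scope ring_scope.

(* Probability of [k] consecutive epsilon-transitions from [s], for
   [E s r] the probability of an epsilon-transition from [s] to [r]. *)
Fixpoint survival (k : nat) (s : S) : R :=
  if k is j.+1 then \sum_r E s r * survival j r else 1.

Lemma survival_ge0 k s : 0 <= survival k s.
Proof. by elim: k s => //= k ih s; apply: sumr_ge0 => r _; rewrite mulr_ge0. Qed.

Lemma survival_le1 k s : survival k s <= 1.
Proof.
elim: k s => //= k ih s; apply: le_trans (E_le1 s).
by apply: ler_sum => r _; rewrite ler_piMr.
Qed.

Lemma survival_anti j k s : (j <= k)%N -> survival k s <= survival j s.
Proof.
elim: j k s => [|j ih] [|k] s //= jk; first exact: (survival_le1 k.+1).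
by apply: ler_sum => r _; rewrite ler_wpM2l// ih.
Qed.

(* A multiple of the truncated Green function [\sum_(j < N) survival j]
   suffices once [survival N] is everywhere below 1. *)
Lemma potential : (forall s, exists k, survival k s < 1) ->
  exists h : S -> R, (forall s, 0 <= h s) /\
    (forall s, 1 + \sum_r E s r * h r <= h s).
Proof.
(* Survival decreases with length, so the largest of the finitely many [K s] serves all states at
   once. *)
move=> /choice[K KP]; pose N := (\max_s K s)%N.
have NP s : 0 < 1 - survival N s.
  rewrite subr_gt0; apply: le_lt_trans (KP s); apply: survival_anti.
  exact: leq_bigmax.
(* The sum of these positive inverses dominates each of them, which gives a constant independent of
   the state. *)
pose c := \sum_s (1 - survival N s)^-1.
have cP s : 1 <= c * (1 - survival N s).
  rewrite -ler_pdivrMr// div1r /c (bigD1 s)//= lerDl.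
  by apply: sumr_ge0 => r _; rewrite invr_ge0 ltW.
have c0 : 0 <= c by apply: sumr_ge0 => r _; rewrite invr_ge0 ltW.
exists (fun s => c * \sum_(j < N) survival j s); split=> [s|s].
  by rewrite mulr_ge0// sumr_ge0// => j _; exact: survival_ge0.
have -> : \sum_r E s r * (c * \sum_(j < N) survival j r) =
          c * \sum_(j < N) survival j.+1 s.
  rewrite exchange_big/= mulr_sumr; apply: eq_bigr => r _.
  by rewrite mulrCA mulr_sumr.
(* The sums over [j] and [j.+1] telescope to [1 - survival N s], which leaves [cP]. *)
rewrite -lerBrDr -mulrBr; apply: le_trans (cP s) _; rewrite ler_wpM2l//.
have := @big_ord_recr _ 0 +%R N (fun j : 'I_N.+1 => survival j s).
rewrite big_ord_recl => /= H.
by rewrite lerBrDr addrAC H addrK.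
Qed.

End Potential.

(** * Weighted sums over paths *)

Section PathSum.
Variables (R : realType) (S : finType) (Sigma : choiceType).
Variable M : eps_hmm R S Sigma.
Local Notation altseq := (altseq S Sigma).
Implicit Types (g : altseq -> R) (y : seq Sigma) (s r : S).

Lemma delta_ge0 s x : (0 <= delta M s x)%R.
Proof. by have [/(_ x)/andP[]] := delta_prob_fun M s. Qed.

Lemma seqprob_ge0 (z : altseq) : (0 <= seqprob M z)%R.
Proof. by apply: prodr_ge0 => t _; exact: delta_ge0. Qed.

Lemma sum_delta_uniq s (l : seq (option Sigma * S)) :
  uniq l -> (\sum_(x <- l) delta M s x <= 1)%R.
Proof.
move=> ul; have [_ d1] := delta_prob_fun M s.
rewrite -lee_fin -d1 -sumEFin; apply: esum_ge; exists [set` l]%classic.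
  by split=> //; exact: finite_seq.
by rewrite fsbig_seq.
Qed.

Lemma sum_delta_le1 s a :
  (\sum_r delta M s (Some a, r) + \sum_r delta M s (None, r) <= 1)%R.
Proof.
pose l := [seq (Some a, r) | r <- index_enum S] ++ [seq (None, r) | r <- index_enum S].
have /sum_delta_uniq : uniq l.
  have inj b : injective (fun r : S => (b, r) : option Sigma * S) by move=> ? ? [].
  rewrite cat_uniq !(map_inj_uniq (inj _)) !index_enum_uniq andbT/=.
  by apply/hasPn => _ /mapP[r _ ->]; apply/mapP => -[].
by move=> /(_ s); rewrite big_cat !big_map.
Qed.

Lemma sum_delta_None_le1 s : (\sum_r delta M s (None, r) <= 1)%R.
Proof.
have /sum_delta_uniq : uniq [seq (None : option Sigma, r) | r <- index_enum S].
  by rewrite map_inj_uniq ?index_enum_uniq// => ? ? [].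
by move=> /(_ s); rewrite big_map.
Qed.

(** Induction along an emitting path: an observable first transition takes mass away from the
    epsilon-transitions, so length 1 works; an epsilon-transition of positive probability passes
    strictness back from its target, at the cost of one more step. *)
Lemma survival_lt1 : always_emits M ->
  forall s, exists k, (survival (fun s r => delta M s (None, r)) k s < 1)%R.
Proof.
move=> HM s; have [[s' p] [[/= -> pP]]] := HM s.
rewrite /contains_symbol/= /triples/= in pP *.
elim: p {s'} s pP => //= -[b r] p ih s pP.
have sr : (0 < delta M s (b, r))%R by apply: (pP (s, b, r)); rewrite inE eqxx.
case: b => [a|] in sr pP *.
  move=> _; exists 1%N => /=; under eq_bigr do rewrite mulr1.
  apply: lt_le_trans (sum_delta_le1 s a); rewrite ltrDr.
  rewrite (bigD1 r)//= ltr_pwDl// sumr_ge0// => i _; exact: delta_ge0.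
rewrite /observable/= => /(ih r)[t tp|k kP].
  by apply: pP; rewrite inE tp orbT.
exists k.+1 => /=; apply: lt_le_trans (sum_delta_None_le1 s).
rewrite (bigD1 r)//= [ltRHS](bigD1 r)//=; apply: ltr_leD.
  by rewrite gtr_pMr.
apply: ler_sum => i _; rewrite ler_piMr ?delta_ge0// survival_le1//.
  by move=> *; exact: delta_ge0.
exact: sum_delta_None_le1.
Qed.

Definition prepend s (b : option Sigma) (z : altseq) : altseq :=
  (s, (b, z.1) :: z.2).

(** The unnormalised expectation of [g] over the paths from [s] with word [y]: the constant 1 gives
    [PY], the count of [t] gives [Ccount]. *)
Definition pathsum g y s : \bar R :=
  \esum_(p in Lang y) (seqprob M (s, p) * g (s, p))%:E.

Lemma seqprob_cons s b r p :
  seqprob M (s, (b, r) :: p) = (delta M s (b, r) * seqprob M (r, p))%R.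
Proof. by rewrite /seqprob /triples/= big_cons. Qed.

Lemma pathsum_ge0 g y s : (forall z, 0 <= g z)%R -> 0 <= pathsum g y s.
Proof.
by move=> g0; apply: esum_ge0 => p _; rewrite lee_fin mulr_ge0// seqprob_ge0.
Qed.

Lemma le_pathsum g g' y s : (forall z, g z <= g' z)%R ->
  pathsum g y s <= pathsum g' y s.
Proof.
by move=> gg; apply: le_esum => p _; rewrite lee_fin ler_wpM2l// seqprob_ge0.
Qed.

Lemma eq_pathsum g g' y s : (forall p, g (s, p) = g' (s, p)) ->
  pathsum g y s = pathsum g' y s.
Proof. by move=> gg; apply: eq_esum => p _; rewrite gg. Qed.

Lemma pathsumD g g' y s : (forall z, 0 <= g z)%R -> (forall z, 0 <= g' z)%R ->
  pathsum (fun z => g z + g' z)%R y s = pathsum g y s + pathsum g' y s.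
Proof.
move=> g0 g'0; rewrite -esumD.
- by apply: eq_esum => p _; rewrite mulrDr EFinD.
- by move=> p _; rewrite lee_fin mulr_ge0// seqprob_ge0.
- by move=> p _; rewrite lee_fin mulr_ge0// seqprob_ge0.
Qed.

Lemma pathsumZl c g y s : (0 <= c)%R -> (forall z, 0 <= g z)%R ->
  pathsum (fun z => c * g z)%R y s = c%:E * pathsum g y s.
Proof.
move=> c0 g0; rewrite -esumZl//; first by apply: eq_esum => p _; rewrite mulrCA EFinM.
by move=> p _; rewrite lee_fin mulr_ge0// seqprob_ge0.
Qed.

Lemma pathsum_nil g s : (0 <= g (s, [::]))%R ->
  pathsum g [::] s = (g (s, [::]))%:E.
Proof.
by move=> g0; rewrite /pathsum Lang_nil esum_set1 /seqprob /triples/= big_nil mul1r.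
Qed.

Lemma pathsum_cons g a y s : (forall z, 0 <= g z)%R ->
  pathsum g (a :: y) s =
    \sum_r (delta M s (Some a, r))%:E * pathsum (g \o prepend s (Some a)) y r
  + \sum_r (delta M s (None, r))%:E * pathsum (g \o prepend s None) (a :: y) r.
Proof.
move=> g0; rewrite /pathsum esum_Lang_cons; last first.
  by move=> p; rewrite lee_fin mulr_ge0// seqprob_ge0.
have step b y' r :
    \esum_(p in Lang y') (seqprob M (s, (b, r) :: p) * g (s, (b, r) :: p))%:E =
    (delta M s (b, r))%:E * pathsum (g \o prepend s b) y' r.
  rewrite -esumZl ?delta_ge0//; last first.
    by move=> p _; rewrite lee_fin mulr_ge0 ?seqprob_ge0/=.
  by apply: eq_esum => p _; rewrite seqprob_cons -mulrA EFinM.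
by congr (_ + _); apply: eq_bigr => r _; exact: step.
Qed.

(* The bound is strict, so that [trunc 0 g] vanishes. *)
Definition trunc (k : nat) g (z : altseq) : R :=
  if (size z.2 < k)%N then g z else 0%R.

Lemma trunc_ge0 k g z : (forall z, 0 <= g z)%R -> (0 <= trunc k g z)%R.
Proof. by move=> g0; rewrite /trunc; case: ifP. Qed.

Lemma trunc_le k g z : (forall z, 0 <= g z)%R -> (trunc k g z <= g z)%R.
Proof. by move=> g0; rewrite /trunc; case: ifP. Qed.

(** A form of monotone convergence: [pathsum] is a supremum over finite sets of paths, and a long
    enough truncation leaves [g] unchanged on a given finite set. *)
Lemma pathsum_trunc_le g y s u : (forall z, 0 <= g z)%R ->
  (forall k, pathsum (trunc k g) y s <= u) -> pathsum g y s <= u.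
Proof.
move=> g0 gu; apply: ge_ereal_sup => _ [X [finX XL] <-].
pose k := (\max_(p <- finmap.enum_fset (fset_set X)) (size p).+1)%N.
apply: le_trans (gu k); apply: esum_ge; exists X => //.
apply: lee_fsum => // p Xp; rewrite /trunc/= leq_bigmax_seq//.
by rewrite in_fset_set// inE.
Qed.

Lemma pathsum_trunc0 g y s : pathsum (trunc 0 g) y s = 0.
Proof. by apply: esum1 => p _; rewrite /trunc/= mulr0. Qed.

(** The induction is on the truncation length, because the epsilon summand keeps the word while
    every transition shortens the path. *)
Lemma pathsum1_le1 y s : pathsum (fun=> 1%R) y s <= 1.
Proof.
apply: pathsum_trunc_le => // k; elim: k y s => [|k ih] y s.
  by rewrite pathsum_trunc0.
case: y => [|a y]; first by rewrite pathsum_nil /trunc//=.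
rewrite pathsum_cons; last by move=> z; exact: trunc_ge0.
apply: (@le_trans _ _ (\sum_r (delta M s (Some a, r))%:E
                        + \sum_r (delta M s (None, r))%:E)).
  (* Composed with [prepend], truncation at [k.+1] is convertible to truncation at [k], so [ih]
     applies. *)
  by apply: leeD; apply: lee_sum => r _; rewrite -[leRHS]mule1;
    apply: lee_wpmul2l; rewrite ?lee_fin ?delta_ge0.
by rewrite !sumEFin -EFinD lee_fin sum_delta_le1.
Qed.

(** * Finiteness of the expected path length *)

Definition seqlen (z : altseq) : R := (size z.2)%:R.

(** Only the epsilon summand stays truncated, for the induction on [k]; the observable one has a
    shorter word and is left to the induction on the word. *)
Lemma pathsum_len_cons k a y s :
  pathsum (trunc k.+1 seqlen) (a :: y) s <=
  1 + \sum_r (delta M s (Some a, r))%:E * pathsum seqlen y r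
    + \sum_r (delta M s (None, r))%:E * pathsum (trunc k seqlen) (a :: y) r.
Proof.
have l0 z : (0 <= seqlen z)%R by exact: ler0n.
rewrite pathsum_cons; last by move=> z; exact: trunc_ge0.
(* The first transition adds 1 to the length, and the constant 1 has path sum at most 1. *)
have step b y' r : pathsum (trunc k.+1 seqlen \o prepend s b) y' r <=
    1 + pathsum (trunc k seqlen) y' r.
  apply: le_trans (leeD (pathsum1_le1 y' r) (lexx _)).
  rewrite -pathsumD//; last by move=> z; exact: trunc_ge0.
  apply: le_pathsum => z; rewrite /trunc/= ltnS /seqlen/=.
  by case: ifP => _; rewrite ?addr0// -nat1r.
apply: (@le_trans _ _ (\sum_r (delta M s (Some a, r))%:E * (1 + pathsum seqlen y r) +
   \sum_r (delta M s (None, r))%:E * (1 + pathsum (trunc k seqlen) (a :: y) r))).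
  apply: leeD; apply: lee_sum => r _; apply: lee_wpmul2l;
    rewrite ?lee_fin ?delta_ge0//.
  apply: le_trans (step _ _ _) _; apply: leeD => //; apply: le_pathsum => z.
  exact: trunc_le.
have dD b y' g : (forall z, 0 <= g z)%R ->
    \sum_r (delta M s (b, r))%:E * (1 + pathsum g y' r) =
    (\sum_r (delta M s (b, r)))%:E + \sum_r (delta M s (b, r))%:E * pathsum g y' r.
  move=> g0; rewrite -sumEFin -big_split/=; apply: eq_bigr => r _.
  by rewrite ge0_muleDr ?mule1// pathsum_ge0.
rewrite !dD//; last by move=> z; exact: trunc_ge0.
(* The two constants together are the mass of the transitions labelled [a] or epsilon. *)
rewrite addeACA -EFinD -[leRHS]addeA; apply: leeD => //.
by rewrite lee_fin sum_delta_le1.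
Qed.

Lemma pathsum_len_bounded : always_emits M ->
  forall y, exists C : R, forall s, pathsum seqlen y s <= C%:E.
Proof.
move=> HM; have [h [h0 hE]] := potential (fun s r => delta_ge0 s (None, r))
  sum_delta_None_le1 (survival_lt1 HM).
have l0 z : (0 <= seqlen z)%R by exact: ler0n.
elim=> [|a y [C CP]]; first by exists 0%R => s; rewrite pathsum_nil.
pose D := Num.max C 0%R.
have D0 : (0 <= D)%R by rewrite le_max lexx orbT.
have DP s : pathsum seqlen y s <= D%:E.
  by apply: le_trans (CP s) _; rewrite lee_fin le_max lexx.
(* The factor [1 + D] closes the recursion: by [hE], [1 + D] plus [1 + D] times the epsilon-average
   of [h] is at most [1 + D] times [h s], uniformly in [k]. *)
have bd k s : pathsum (trunc k seqlen) (a :: y) s <= ((1 + D) * h s)%:E.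
  elim: k s => [|k ih] s.
    by rewrite pathsum_trunc0 lee_fin mulr_ge0// addr_ge0.
  apply: le_trans (pathsum_len_cons _ _ _ _) _.
  apply: (@le_trans _ _ (1 + D%:E + ((1 + D) * \sum_r delta M s (None, r) * h r)%:E)).
    rewrite mulr_sumr -sumEFin; apply: leeD.
      apply: leeD => //; apply: (@le_trans _ _ (\sum_r (delta M s (Some a, r))%:E * D%:E)).
        by apply: lee_sum => r _; rewrite lee_wpmul2l// lee_fin delta_ge0.
      rewrite -ge0_sume_distrl; last by move=> r _; rewrite lee_fin delta_ge0.
      rewrite -[leRHS]mul1e; apply: lee_wpmul2r; rewrite ?lee_fin// sumEFin lee_fin.
      apply: le_trans (sum_delta_le1 s a); rewrite lerDl sumr_ge0// => r _.
      exact: delta_ge0.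
    apply: lee_sum => r _; rewrite mulrCA EFinM lee_wpmul2l// lee_fin delta_ge0//.
  rewrite -!EFinD lee_fin -[X in (X + _ <= _)%R]mulr1 -mulrDr.
  by rewrite ler_wpM2l// addr_ge0.
(* Summing [h] over all states makes the bound independent of the start state. *)
exists ((1 + D) * \sum_r h r)%R => s; apply: pathsum_trunc_le => // k.
apply: le_trans (bd k s) _; rewrite lee_fin ler_wpM2l ?addr_ge0//.
by rewrite (bigD1 s)//= lerDl sumr_ge0.
Qed.

(** * Probabilities and expected counts as path sums *)

Lemma Omega_Yword y s :
  (Omega (size y) s `&` [set z | Yword z = y] = (fun p => (s, p)) @` Lang y)%classic.
Proof.
apply/seteqP; split=> [[s' p] [[/= -> _ pe] py]|_ [p [py pe] <-]].
  by exists p.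
by split=> //; split=> //; rewrite -py size_pmap.
Qed.

Lemma esum_Omega_Yword (f : altseq -> \bar R) y s :
  \esum_(z in (Omega (size y) s `&` [set z | Yword z = y])%classic) f z =
  \esum_(p in Lang y) f (s, p).
Proof. by rewrite Omega_Yword esum_image// => p q _ _ []. Qed.

Lemma PY_pathsum s y : PY M s y = pathsum (fun=> 1%R) y s.
Proof.
by rewrite /PY /Pr esum_Omega_Yword; apply: eq_esum => p _; rewrite mulr1.
Qed.

Lemma PY_fin_num s y : PY M s y \is a fin_num.
Proof.
rewrite ge0_fin_numE PY_pathsum ?pathsum_ge0//.
by apply: le_lt_trans (pathsum1_le1 y s) _; rewrite ltry.
Qed.

Lemma Pr_set1 n s z (B : set altseq) : Omega n s z ->
  Pr M n s ([set w | w = z] `&` B)%classic =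
  if z \in B then (seqprob M z)%:E else 0.
Proof.
move=> Oz; rewrite /Pr setIA esum_mkcondr (_ : _ `&` _ = [set z])%classic.
  by rewrite esum_set1//; case: ifP => // _; rewrite lee_fin seqprob_ge0.
by apply/seteqP; split=> [w []//|w ->].
Qed.

Lemma Ccount_pathsum t y s :
  Ccount M y s t = pathsum (fun z => (Xcount t z)%:R)%R y s.
Proof.
have [p0|pn0] := eqVneq (PY M s y) 0.
  (* When [PY] is 0, each path with word [y] has probability 0, being a term of a vanishing
     nonnegative sum. *)
  rewrite /Ccount p0 mule0; apply/esym/esum1 => p Lp; congr (_%:E).
  have : (seqprob M (s, p) * 1)%:E <= 0.
    rewrite -p0 PY_pathsum.
    apply: (ge0_ler_esum (f := fun p => (seqprob M (s, p) * 1)%:E)) => // q _.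
    by rewrite lee_fin mulr1 seqprob_ge0.
  rewrite lee_fin mulr1 => sp; suff -> : seqprob M (s, p) = 0%R by rewrite mul0r.
  by apply/eqP; rewrite eq_le sp seqprob_ge0.
have /fineK pE := PY_fin_num s y; set r := fine _ in pE.
have r0 : r != 0%R by apply: contraNneq pn0 => r0; rewrite -pE r0.
have r_ge0 : (0 <= r)%R by rewrite fine_ge0// PY_pathsum pathsum_ge0.
rewrite /Ccount /cE -pE.
(* The conditional probability of [z] is [seqprob M z] over [r] if [z] has word [y], and 0
   otherwise; this restricts the sum to [Lang y]. *)
rewrite (eq_esum (b := fun z => if z \in [set w | Yword w = y]%classic
  then (r^-1)%:E * (seqprob M z * (Xcount t z)%:R)%:E else 0)); last first.
  move=> z Oz; rewrite /cPr -/(PY M s y) -pE inver (negbTE r0) Pr_set1//.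
  by case: ifP => _; rewrite ?mul0e ?mule0// -!EFinM
    mulrC mulrA mulrAC mulrC mulrA mulrC.
rewrite -esum_mkcondr esum_Omega_Yword esumZl ?invr_ge0//; last first.
  by move=> p _; rewrite lee_fin mulr_ge0 ?seqprob_ge0.
by rewrite muleAC -EFinM mulVf// mul1e.
Qed.

(** A transition occurs at most as often as the path has transitions, so the bound on the expected
    length applies. *)
Lemma Ccount_fin_num : always_emits M -> forall t y s,
  Ccount M y s t \is a fin_num.
Proof.
move=> HM t y s; have [C CP] := pathsum_len_bounded HM y.
rewrite Ccount_pathsum ge0_fin_numE ?pathsum_ge0//.
apply: le_lt_trans (ltry C); apply: le_trans (CP s); apply: le_pathsum => z.
rewrite /seqlen ler_nat /Xcount; apply: leq_trans (count_size _ _) _.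
rewrite /triples; case: z => r p /=.
by elim: p r => //= -[b r'] p ih r /=; rewrite ltnS.
Qed.

Lemma Ccount_nil t s : Ccount M [::] s t = 0.
Proof. by rewrite Ccount_pathsum pathsum_nil. Qed.

(** Prepending a transition raises the count by one exactly when it equals [t], which among the
    targets [r] can happen only at [t.2]; so one indicator term survives. *)
Lemma sum_prepend_count (t : triple S Sigma) s b y :
  \sum_r (delta M s (b, r))%:E *
    pathsum ((fun z => (Xcount t z)%:R)%R \o prepend s b) y r =
  \sum_r (delta M s (b, r))%:E * Ccount M y r t +
  ((s, b) == t.1)%:R%:E * (delta M t.1.1 (b, t.2))%:E * PY M t.2 y.
Proof.
have step r : pathsum ((fun z => (Xcount t z)%:R)%R \o prepend s b) y r =
    Ccount M y r t + ((s, b, r) == t)%:R%:E * PY M r y.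
  rewrite Ccount_pathsum PY_pathsum -pathsumZl// -pathsumD//.
    by apply: eq_pathsum => p; rewrite mulr1 /Xcount/= natrD addrC.
rewrite (eq_bigr (fun r => (delta M s (b, r))%:E * Ccount M y r t +
    (delta M s (b, r))%:E * (((s, b, r) == t)%:R%:E * PY M r y))); last first.
  move=> r _; rewrite step ge0_muleDr//.
    by rewrite Ccount_pathsum pathsum_ge0.
  by rewrite mule_ge0// PY_pathsum pathsum_ge0.
rewrite big_split/=; congr (_ + _); rewrite (bigD1 t.2)//= big1 ?adde0.
  case: t {step} => -[s' b'] r' /=; rewrite !xpair_eqE eqxx andbT.
  case: (eqVneq s s') => [->|] /=; last by rewrite !mul0e mule0.
  by rewrite muleA; congr (_ * _); rewrite muleC.
move=> r; case: t {step} => -[s' b'] r' /= rr'.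
by rewrite !xpair_eqE (negbTE rr') andbF mul0e mule0.
Qed.

(** This form is uniform in the label of [t]: at most one of the two indicators is nonzero, and
    fixing the label gives the two cases of the fixpoint equation. *)
Lemma Ccount_cons (t : triple S Sigma) s a y :
  Ccount M (a :: y) s t =
    \sum_r (delta M s (Some a, r))%:E * Ccount M y r t
  + \sum_r (delta M s (None, r))%:E * Ccount M (a :: y) r t
  + (((s, Some a) == t.1)%:R%:E * (delta M t.1.1 (Some a, t.2))%:E * PY M t.2 y
     + ((s, None) == t.1)%:R%:E * (delta M t.1.1 (None, t.2))%:E *
       PY M t.2 (a :: y)).
Proof.
by rewrite Ccount_pathsum pathsum_cons// !sum_prepend_count addeACA.
Qed.

End PathSum.

Theorem proposition5p1 (R : realType) (S : finType) (Sigma : choiceType)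
    (M : eps_hmm R S Sigma) (HM : always_emits M)
    (s0 : S) (a1 : Sigma) (y1 : seq Sigma)
    (Hy : 0 < PY M s0 (a1 :: y1))
    (s : S) (a : option Sigma) (s' : S) (Ht : is_transition M (s, a, s')) :
  let t := (s, a, s') in
  let y := a1 :: y1 in
  [/\ (forall y' r, Ccount M y' r t \is a fin_num),
      Ccount M [::] s0 t = 0,
      (forall b : Sigma, a = Some b ->
         Ccount M y s0 t =
           \sum_(s1 : S) (delta M s0 (Some a1, s1))%:E * Ccount M y1 s1 t
         + \sum_(s1 : S) (delta M s0 (None, s1))%:E * Ccount M y s1 t
         + ((s0 == s) && (a1 == b))%:R%:E
             * (delta M s (Some b, s'))%:E * PY M s' y1)
    & (a = None ->
         Ccount M y s0 t =
           \sum_(s1 : S) (delta M s0 (Some a1, s1))%:E * Ccount M y1 s1 t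
         + \sum_(s1 : S) (delta M s0 (None, s1))%:E * Ccount M y s1 t
         + (s0 == s)%:R%:E * (delta M s (None, s'))%:E * PY M s' y)].
Proof.
move=> t y; split.
- by move=> y' r; exact: Ccount_fin_num.
- exact: Ccount_nil.
- move=> b ab; rewrite Ccount_cons /t ab /= !xpair_eqE andbF !mul0e adde0.
  have [<-|a1b] := eqVneq a1 b; first by rewrite eqxx.
  by rewrite (_ : (Some a1 == Some b) = false) ?andbF ?mul0e//; apply: negbTE.
- by move=> a0; rewrite Ccount_cons /t a0 /= !xpair_eqE andbF andbT !mul0e add0e.
Qed.
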